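(* Let $\psi:\mathcal C_2\to\mathcal P$ be defined by $\psi(C(p,q))=(\sqrt{q^2-p^2},p,q)$ if $2\mid p$ and $\psi(C(p,q))=(p,\sqrt{q^2-p^2},q)$ if $2\nmid p$. Then $\psi$ is a bijection; the map $\varphi:\mathcal P\to H'$, $\varphi(x,y,z)=$ the element $M\in H'$ with $M(1,0,1)^t=(x,y,z)^t$, is a well-defined bijection; and the binary operation on $\mathcal C_2$ $$C(p_1,q_1)*C(p_2,q_2)=\psi^{-1}\big(\varphi\psi(C(p_1,q_1))\,\varphi\psi(C(p_2,q_2))\,(1,0,1)^t\big)$$ makes $\mathcal C_2$ a free, non-commutative, infinitely generated monoid with identity $C(1,1)$ (the class of orthogonal well-rounded lattices), and $\varphi\psi:(\mathcal C_2,* )\to H'$ is a monoid isomorphism. Its Cayley digraph with respect to a free generating set is a regular rooted infinite tree in which every vertex has infinite degree.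
   Context: All lattices are full-rank lattices in $\mathbb R^2$. For a lattice $\Lambda$, $|\Lambda|=\min_{x\in\Lambda\setminus\{0\}}\|x\|$ (Euclidean norm) and $S(\Lambda)=\{x\in\Lambda:\|x\|=|\Lambda|\}$; $\Lambda$ is well-rounded (WR) if $S(\Lambda)$ spans $\mathbb R^2$. $\mathrm{WR}(\mathbb Z^2)$ is the set of full-rank WR sublattices of $\mathbb Z^2$. For a WR lattice $\Lambda$, $\theta(\Lambda)\in[\pi/3,\pi/2]$ is the angle between two linearly independent minimal vectors chosen so that the angle is at most $\pi/2$; equivalently $\sin\theta(\Lambda)=\det(\Lambda)/|\Lambda|^2$. For $q\in\mathbb Z_{>0}$ let $\mathcal S_q=\{p/q\in\mathbb Q\cap(\sqrt3/2,1):\gcd(p,q)=1,\ \sqrt{q^2-p^2}\in\mathbb Z\}$ and $\mathcal S=\bigcup_{q}\mathcal S_q\cup\{1\}$, where $1$ is written as $p/q$ with $p=q=1$; elements of $\mathcal S$ are written in lowest terms. For $p/q\in\mathcal S$, $C(p,q)=\{\Lambda\in\mathrm{WR}(\mathbb Z^2):\sin\theta(\Lambda)=p/q\}$, and $\mathcal C_2=\{C(p,q):p/q\in\mathcal S\}$ (these are exactly the similarity classes of lattices in $\mathrm{WR}(\mathbb Z^2)$). Let $\mathfrak P=\{(x,y,z)\in\mathbb Z_{>0}^3: 2\mid y,\ \gcd(x,y,z)=1,\ x^2+y^2=z^2\}$ and $\mathcal P=\{(x,y,z)\in\mathfrak P:\min\{x,y\}<z/2\}\cup\{(1,0,1)\}$.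 Let $A=\begin{pmatrix}1&-2&2\\2&-1&2\\2&-2&3\end{pmatrix}$, $B=\begin{pmatrix}1&2&2\\2&1&2\\2&2&3\end{pmatrix}$, $C=\begin{pmatrix}-1&2&2\\-2&1&2\\-2&2&3\end{pmatrix}$, and let $G$ be the monoid of $3\times3$ matrices generated by $I_3,A,B,C$ under multiplication, acting on triples viewed as column vectors. Let $H$ be the set of all matrices of the forms $A^2NB$, $A^kB$, $ABNB$, $C^2NB$, $C^kB$, $CBNB$, $(AC)^kA^2NB$, $(AC)^kABNB$, $(AC)^kAB$, $(CA)^kC^2NB$, $(CA)^kCBNB$, $(CA)^kCB$, with $N\in G$ and $k\in\mathbb Z_{>0}$, and $H'=H\cup\{I_3\}$ (a submonoid of $G$). *)

(* Defs.v *)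
From HB Require Import structures.
From mathcomp Require Import all_boot all_order all_algebra.
From Stdlib Require List.
Set Implicit Arguments. Unset Strict Implicit. Unset Printing Implicit Defensive.
Import Order.TTheory GRing.Theory Num.Theory.
Local Open Scope ring_scope.

Definition pt := (int * int)%type.
Definition norm2 (x : pt) : int := x.1 ^+ 2 + x.2 ^+ 2.
Definition det2 (u v : pt) : int := u.1 * v.2 - u.2 * v.1.
Definition span2 (u v : pt) (x : pt) : Prop :=
  exists m n : int, x = (m * u.1 + n * v.1, m * u.2 + n * v.2).
Definition is_basis (L : pt -> Prop) (u v : pt) : Prop :=
  det2 u v != 0 /\ (forall x, L x <-> span2 u v x).
Definition full_sublattice (L : pt -> Prop) : Prop := exists u v, is_basis L u v.
Definition lat_det (L : pt -> Prop) (d : int) : Prop :=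
  exists u v, is_basis L u v /\ d = `|det2 u v|.
Definition lat_min2 (L : pt -> Prop) (m : int) : Prop :=
  (exists x, L x /\ x != (0, 0) /\ norm2 x = m) /\
  (forall x, L x -> x != (0, 0) -> m <= norm2 x).
Definition WR (L : pt -> Prop) : Prop :=
  full_sublattice L /\
  exists m x y, [/\ lat_min2 L m, L x /\ L y, norm2 x = m, norm2 y = m & det2 x y != 0].
(* sin theta(L) = s, via sin theta(L) = det(L) / |L|^2 *)
Definition sin_theta_is (L : pt -> Prop) (s : rat) : Prop :=
  exists d m, [/\ lat_det L d, lat_min2 L m & s = d%:~R / m%:~R].

(* p/q in lowest terms (q > 0) belongs to S *)
Definition inS (p q : int) : Prop :=
  (p = 1 /\ q = 1) \/
  [/\ 0 < p /\ 0 < q, coprimez p q, 3 * q ^+ 2 < 4 * p ^+ 2, p < q &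
      exists r : int, r ^+ 2 = q ^+ 2 - p ^+ 2].

Definition Ccls (p q : int) (L : pt -> Prop) : Prop :=
  WR L /\ sin_theta_is L (p%:~R / q%:~R).

Definition classC2 := {X : (pt -> Prop) -> Prop | exists p q, inS p q /\ X = Ccls p q}.

Lemma inS11 : inS 1 1. Proof. by left. Qed.
Definition C11 : classC2 := exist _ (Ccls 1 1) (ex_intro _ 1 (ex_intro _ 1 (conj inS11 erefl))).

Definition triple := (int * int * int)%type.
Definition inP (t : triple) : Prop :=
  let: (x, y, z) := t in
  t = (1, 0, 1) \/
  [/\ [/\ 0 < x, 0 < y & 0 < z], (2 %| y)%Z,
      gcdz (gcdz x y) z = 1, x ^+ 2 + y ^+ 2 = z ^+ 2 &
      2 * Num.min x y < z].

(* the triple psi(C(p,q)), where r = sqrt(q^2 - p^2) *)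
Definition psi_val (p q r : int) : triple :=
  if (2 %| p)%Z then (r, p, q) else (p, r, q).

Definition mx3 (rows : seq (seq int)) : 'M[int]_3 :=
  \matrix_(i < 3, j < 3) nth 0 (nth [::] rows i) j.
Definition matA := mx3 [:: [:: 1; -2; 2]; [:: 2; -1; 2]; [:: 2; -2; 3]].
Definition matB := mx3 [:: [:: 1; 2; 2]; [:: 2; 1; 2]; [:: 2; 2; 3]].
Definition matC := mx3 [:: [:: -1; 2; 2]; [:: -2; 1; 2]; [:: -2; 2; 3]].

Definition tri (t : triple) : 'cV[int]_3 :=
  let: (x, y, z) := t in \col_(i < 3) nth 0 [:: x; y; z] i.
Definition v101 : 'cV[int]_3 := tri (1, 0, 1).

Inductive inG : 'M[int]_3 -> Prop :=
| inG1 : inG 1%:M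
| inGA M : inG M -> inG (matA *m M)
| inGB M : inG M -> inG (matB *m M)
| inGC M : inG M -> inG (matC *m M).

Definition inH (M : 'M[int]_3) : Prop :=
  exists (N : 'M[int]_3) (k : nat), inG N /\ (0 < k)%N /\
  let A := matA in let B := matB in let C := matC in
  [\/ [\/ M = A ^+ 2 *m N *m B, M = A ^+ k *m B | M = A *m B *m N *m B],
      [\/ M = C ^+ 2 *m N *m B, M = C ^+ k *m B | M = C *m B *m N *m B],
      [\/ M = (A *m C) ^+ k *m A ^+ 2 *m N *m B, M = (A *m C) ^+ k *m A *m B *m N *m B
         | M = (A *m C) ^+ k *m A *m B] |
      [\/ M = (C *m A) ^+ k *m C ^+ 2 *m N *m B, M = (C *m A) ^+ k *m C *m B *m N *m B
         | M = (C *m A) ^+ k *m C *m B]].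

Definition inH' (M : 'M[int]_3) : Prop := inH M \/ M = 1%:M.

Section Monoid.
Variables (T : Type) (mul : T -> T -> T) (e : T).

Definition is_monoid : Prop :=
  (forall x y z, mul x (mul y z) = mul (mul x y) z) /\
  (forall x, mul e x = x /\ mul x e = x).

Definition wprod (w : seq T) : T := foldr mul e w.

Definition free_basis (B : T -> Prop) : Prop :=
  forall x, exists! w : seq T, (forall b, List.In b w -> B b) /\ wprod w = x.

Definition finitely_generated : Prop :=
  exists l : seq T, forall x, exists w : seq T,
    (forall b, List.In b w -> List.In b l) /\ wprod w = x.

Definition infinite_set (B : T -> Prop) : Prop :=
  forall l : seq T, exists b, B b /\ ~ List.In b l.

(* Cayley digraph w.r.t. B: vertices T, an edge x -> mul x b for each b in B.
   It is a rooted tree (root e) that is regular of infinite degree: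
   - no edge enters the root, every other vertex has exactly one entering edge;
   - every vertex is reachable from the root by a directed path;
   - the edges leaving any vertex x are in bijection with B (b |-> mul x b
     injective on B), so every vertex has out-degree |B|, which is infinite. *)
Definition cayley_regular_rooted_infinite_tree (B : T -> Prop) : Prop :=
  [/\ forall x b, B b -> mul x b <> e,
      forall x, x <> e -> exists! yb : T * T, B yb.2 /\ mul yb.1 yb.2 = x,
      forall x, exists w : seq T, (forall b, List.In b w -> B b) /\
                 foldl mul e w = x,
      forall x b1 b2, B b1 -> B b2 -> mul x b1 = mul x b2 -> b1 = b2 &
      infinite_set B].
End Monoid.

(* Main.v *)
Require Import Defs.
From HB Require Import structures.
From mathcomp Require Import all_boot all_order all_algebra.
From mathcomp Require Import ring zify.
From Stdlib Require Import Classical ClassicalEpsilon ProofIrrelevance.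
Import Order.TTheory GRing.Theory Num.Theory.
Local Open Scope ring_scope.

(** Descent in the tree of Pythagorean triples writes every primitive triple
    as [w (1,0,1)] for a unique word [w] in [A], [B], [C] ending in [B].
    Since [A] and [C] exchange the linear forms [z - 2x] and [z - 2y] up to
    sign, one of them is positive on [w (1,0,1)] exactly when [w] has a prefix
    [(AC)^k A b] with [b <> C] or [(CA)^k C b] with [b <> A]; these words give
    [H].  Such a prefix contains [B] at most as its last letter, whence [H'] is
    a stable submonoid of the free monoid on [A], [B], [C] and therefore free;
    all the words [A^k B] are irreducible in it, so it is not finitely
    generated.  On the lattice side, [C(p,q)] contains the lattice spanned by
    [(q,0)] and [(r,p)] with [r^2 = q^2 - p^2], so the class determines
    [p/q]. *)

(** * Free monoids and their stable submonoids *)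

(** Levi's lemma: of two prefixes of one word, one extends the other, and the difference [s] moves
    between the suffixes. *)
Lemma cat_eq_cat (L : Type) (u1 v1 u2 v2 : seq L) : u1 ++ v1 = u2 ++ v2 ->
  exists s, (u1 = u2 ++ s /\ v2 = s ++ v1) \/ (u2 = u1 ++ s /\ v1 = s ++ v2).
Proof.
elim: u1 u2 => [|a u1 IH] [|b u2] //=.
- by move=> ->; exists [::]; left.
- by move=> ->; exists (b :: u2); right.
- by move=> <-; exists (a :: u1); left.
- by case=> <- /IH[s [[-> ->]|[-> ->]]]; exists s; [left|right].
Qed.

Set Implicit Arguments.
Section MonoidFacts.
Variables (T : Type) (mul : T -> T -> T) (e : T).
Hypothesis mulP : is_monoid mul e.

Let mulA x y z : mul x (mul y z) = mul (mul x y) z. Proof. exact: mulP.1. Qed.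
Let mul1 x : mul e x = x. Proof. exact: (mulP.2 x).1. Qed.
Let mule x : mul x e = x. Proof. exact: (mulP.2 x).2. Qed.

Lemma wprod_cat u v : wprod mul e (u ++ v) = mul (wprod mul e u) (wprod mul e v).
Proof. by elim: u => [|a u IH] /=; rewrite ?mul1 // IH mulA. Qed.

Lemma wprod_rcons u b : wprod mul e (rcons u b) = mul (wprod mul e u) b.
Proof. by rewrite -cats1 wprod_cat /= mule. Qed.

Lemma foldl_wprod w x : foldl mul x w = mul x (wprod mul e w).
Proof. by elim: w x => [|a w IH] x /=; rewrite ?mule // IH mulA. Qed.

Lemma List_In_rcons (b c : T) w : List.In b (rcons w c) <-> List.In b w \/ b = c.
Proof.
elim: w => [|a w IH] /=; first by split=> [[->|[]]|[[]|->]]; [right|left].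
by rewrite IH; tauto.
Qed.

Lemma List_In_cat (b : T) u v : List.In b (u ++ v) <-> List.In b u \/ List.In b v.
Proof. by elim: u => [|a u IH] /=; [tauto | rewrite IH; tauto]. Qed.

Lemma free_basis_inj Bs : free_basis mul e Bs -> forall u v,
  (forall b, List.In b u -> Bs b) -> (forall b, List.In b v -> Bs b) ->
  wprod mul e u = wprod mul e v -> u = v.
Proof.
move=> frB u v Bu Bv uv; have [w [_ uw]] := frB (wprod mul e v).
by rewrite -(uw u) ?(uw v).
Qed.

(** A vertex is its unique word over the basis, and its parent drops the last letter. A finite basis
    would generate the monoid, so the out-degree is infinite. *)
Lemma free_basis_cayley Bs :
  ~ finitely_generated mul e -> free_basis mul e Bs ->
  cayley_regular_rooted_infinite_tree mul e Bs.
Proof.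
move=> nfg frB; have inj := free_basis_inj frB.
have rconsB w b : (forall c, List.In c w -> Bs c) -> Bs b ->
    forall c, List.In c (rcons w b) -> Bs c.
  by move=> Bw Bb c /List_In_rcons[/Bw|->].
split.
- move=> x b Bb; have [w [[Bw <-] _]] := frB x; rewrite -wprod_rcons => wbe.
  have /(congr1 size) : rcons w b = [::] by apply: inj => //; exact: rconsB.
  by rewrite size_rcons.
- move=> x xe; have [w [[Bw wx] _]] := frB x.
  case/lastP: w Bw wx => [|w b] Bw wx; first by case: xe; rewrite -wx.
  have Bw' c : List.In c w -> Bs c by move=> cw; apply/Bw/List_In_rcons; left.
  have Bb : Bs b by apply/Bw/List_In_rcons; right.
  exists (wprod mul e w, b); split=> /=; first by rewrite -wprod_rcons.
  case=> y c /= [Bc]; have [u [[Bu <-] _]] := frB y.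
  rewrite -wprod_rcons -wx => uw.
  have /rcons_inj[-> ->] // : rcons u c = rcons w b.
  by apply: inj => //; exact: rconsB.
- move=> x; have [w [[Bw wx] _]] := frB x; exists w.
  by rewrite foldl_wprod mul1.
- move=> x b c Bb Bc; have [w [[Bw <-] _]] := frB x.
  rewrite -!wprod_rcons => /inj E.
  suff /rcons_inj[->] : rcons w b = rcons w c by [].
  by apply: E; exact: rconsB.
- move=> l; apply: NNPP => nl; apply: nfg; exists l => x.
  have [w [[Bw wx] _]] := frB x; exists w; split=> // b /Bw Bb.
  by apply: NNPP => nb; apply: nl; exists b.
Qed.

Definition irreducible (x : T) :=
  x <> e /\ forall y z, x = mul y z -> y = e \/ z = e.

Lemma irreducible_in_wprod x w : irreducible x -> wprod mul e w = x -> List.In x w.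
Proof.
case=> xe irr; elim: w => [|a w IH] /= wx; first by case: xe.
have [ae|we] := irr _ _ (esym wx).
  by right; apply: IH; rewrite -wx ae mul1.
by left; rewrite -wx we mule.
Qed.

(** Every generating list must contain each irreducible element, by [irreducible_in_wprod], and
    infinitely many of them outgrow any list. *)
Lemma not_finitely_generated (f : nat -> T) :
  injective f -> (forall k, irreducible (f k)) -> ~ finitely_generated mul e.
Proof.
move=> finj firr [l gen].
have fl k : List.In (f k) l.
  have [w [wl wf]] := gen (f k).
  by apply: wl; apply: irreducible_in_wprod (firr k) wf.
have pigeonhole n : forall l, (forall k, (k < n)%N -> List.In (f k) l) -> (n <= size l)%N.
  elim: n => // n IH {fl gen}l fl.
  (* Deleting [f n] from the list keeps all [f k] with [k < n], by injectivity. *)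
  have [l1 [l2 El]] := List.in_split _ _ (fl n (ltnSn n)).
  have := IH (l1 ++ l2); rewrite El !size_cat /= addnS ltnS; apply.
  move=> k kn; apply/List_In_cat.
  have := fl k (ltnW kn); rewrite El => /List_In_cat[|[/finj E|]]; [by left| |by right].
  by rewrite E ltnn in kn.
by have := pigeonhole (size l).+1 l (fun k _ => fl k); rewrite ltnn.
Qed.

(** * Unique factorization in a stable submonoid *)

Section StableSubmonoid.
Variables (L : Type) (th : T -> seq L).
Hypotheses (th_inj : injective th) (th1 : th e = [::])
  (thM : forall x y, th (mul x y) = th x ++ th y)
  (* Schützenberger's stability criterion for a submonoid of a free monoid *)
  (th_stable : forall x y z t s, th x = th y ++ s -> th z = s ++ th t ->
     exists y', th y' = s).

Lemma th_size0 x : size (th x) = 0%N -> x = e.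
Proof. by move=> /size0nil E; apply: th_inj; rewrite E th1. Qed.

(** Only [e] has an empty word, so both factors of a proper product have strictly shorter words; the
    induction is on word length. *)
Lemma irreducible_factorization x :
  exists w, (forall b, List.In b w -> irreducible b) /\ wprod mul e w = x.
Proof.
have [n] := ubnP (size (th x)); elim: n x => // n IH x xn.
have [->|xe] := classic (x = e); first by exists [::].
have [irr|nirr] := classic (irreducible x).
  by exists [:: x]; split=> [b [<-|[]]|] //=; rewrite mule.
have [y [z [xyz ye ze]]] : exists y z, [/\ x = mul y z, y <> e & z <> e].
  apply: NNPP => H; apply: nirr; split=> // y z xyz.
  apply: NNPP => /not_or_and[ye ze]; apply: H; by exists y, z.
have sy : (0 < size (th y))%N by rewrite lt0n; apply/eqP => /th_size0.
have sz : (0 < size (th z))%N by rewrite lt0n; apply/eqP => /th_size0.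
move: xn; rewrite xyz thM size_cat => xn.
have [u [Iu <-]] : exists w, (forall b, List.In b w -> irreducible b)
  /\ wprod mul e w = y by apply: IH; lia.
have [v [Iv <-]] : exists w, (forall b, List.In b w -> irreducible b)
  /\ wprod mul e w = z by apply: IH; lia.
by exists (u ++ v); split; [move=> b /List_In_cat[/Iu|/Iv] | rewrite wprod_cat].
Qed.

(** By Levi's lemma one of [th a], [th b] extends the other by some [s]; stability puts [s] in the
    submonoid, and irreducibility forces it to be empty. *)
Lemma irreducible_mul_inj a b x y : irreducible a -> irreducible b ->
  mul a x = mul b y -> a = b /\ x = y.
Proof.
have main c d u v s : irreducible c -> irreducible d ->
    th c = th d ++ s -> th v = s ++ th u -> c = d /\ u = v.
  move=> [_ Ic] [de _] cd vu; have [d' Ed] : exists d', th d' = s by apply: th_stable cd vu.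
  have cdd : c = mul d d' by apply: th_inj; rewrite thM Ed.
  have [//|d'e] := Ic _ _ cdd.
  move: cd vu; rewrite -Ed d'e th1 cats0 => /th_inj -> /th_inj ->; by [].
move=> Ia Ib /(congr1 th); rewrite !thM => /cat_eq_cat[s [[ab yx]|[ba xy]]].
  exact: main Ia Ib ab yx.
by have [-> ->] := main _ _ _ _ _ Ib Ia ba xy.
Qed.

Lemma stable_submonoid_free : free_basis mul e irreducible.
Proof.
move=> x; have [w [Iw wx]] := irreducible_factorization x.
exists w; split=> // v [Iv]; rewrite -wx {x wx}.
have ne (a : T) u : irreducible a -> mul a u <> e.
  case=> ae _ /(congr1 th)/(congr1 size); rewrite thM th1 size_cat => /eqP.
  by rewrite addn_eq0 => /andP[/eqP/th_size0].
elim: w v Iw Iv => [|a w IH] [|b v] //= Iw Iv.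
- by move=> E; case: (ne b (wprod mul e v)) => //; apply: Iv; left.
- by move=> /esym E; case: (ne a (wprod mul e w)) => //; apply: Iw; left.
have Ia : irreducible a by apply: Iw; left.
have Ib : irreducible b by apply: Iv; left.
move=> /(irreducible_mul_inj Ib Ia)[-> vw]; congr (_ :: _).
by apply: IH => // c cw; [apply: Iw | apply: Iv]; right.
Qed.

End StableSubmonoid.
End MonoidFacts.
Unset Implicit Arguments.

(** * Words for the elements of [H] *)

Inductive letter := LA | LB | LC.

Definition letter_eqb (a b : letter) : bool :=
  match a, b with LA, LA | LB, LB | LC, LC => true | _, _ => false end.

Lemma letter_eqbP : Equality.axiom letter_eqb.
Proof. by case; case; constructor. Qed.

HB.instance Definition _ := hasDecEq.Build letter letter_eqbP.

Definition lmat (l : letter) : 'M[int]_3 :=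
  match l with LA => matA | LB => matB | LC => matC end.

Definition ev (w : seq letter) : 'M[int]_3 :=
  foldr (fun l M => lmat l *m M) 1%:M w.

Lemma ev_cat u v : ev (u ++ v) = ev u *m ev v.
Proof. by elim: u => [|a u IH] /=; rewrite ?mul1mx // IH mulmxA. Qed.

Lemma ev1 l : ev [:: l] = lmat l.
Proof. by rewrite /= mulmx1. Qed.

Lemma inG_ev M : inG M <-> exists w, M = ev w.
Proof.
split=> [|[w ->]].
  elim=> [|N _ [w ->]|N _ [w ->]|N _ [w ->]]; first by exists [::].
  - by exists (LA :: w).
  - by exists (LB :: w).
  - by exists (LC :: w).
by elim: w => [|[] w IH]; constructor.
Qed.

(* [zigzag a c w]: [w] has a prefix [(a c)^k a b] with [b <> c]. *)
Fixpoint zigzag (a c : letter) (w : seq letter) : bool :=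
  if w is x :: y :: w' then (x == a) && ((y == c) ==> zigzag a c w') else false.

Definition endsB (w : seq letter) : bool := if w is a :: u then last a u == LB else false.

Definition wordH (w : seq letter) : bool :=
  endsB w && (zigzag LA LC w || zigzag LC LA w).

Definition wordH' (w : seq letter) : bool := (w == [::]) || wordH w.

(** Matches the recursion of [zigzag], which consumes two letters at a time. *)
Lemma seq_step2_ind (L : Type) (P : seq L -> Prop) :
  P [::] -> (forall a, P [:: a]) -> (forall a b w, P w -> P (a :: b :: w)) ->
  forall w, P w.
Proof.
move=> P0 P1 P2 w; suff: P w /\ forall a, P (a :: w) by case.
by elim: w => [|b w [IH1 IH2]]; split=> // a; apply: P2.
Qed.

Lemma zigzag_cat a c u v : zigzag a c u -> zigzag a c (u ++ v).
Proof.
elim/seq_step2_ind: u => // x y u IH /= /andP[-> /=].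
by case: (y == c) => //=.
Qed.

Lemma endsB_cat u v : endsB v -> endsB (u ++ v).
Proof. by case: v => // b v; case: u => //= a u; rewrite last_cat. Qed.

Lemma endsB_catr u v : endsB (u ++ v) -> v <> [::] -> endsB v.
Proof. by case: v => // b v; case: u => //= a u; rewrite last_cat. Qed.

Lemma endsB_rcons w : endsB w -> exists u, w = u ++ [:: LB].
Proof.
case/lastP: w => // w b; rewrite -cats1 => /endsB_catr bB; exists w.
have /= /eqP-> : endsB [:: b] by exact: bB.
by [].
Qed.

(* A zigzag prefix contains no [B] except possibly as its last letter. *)
Lemma zigzag_endsB a c u v : c != LB -> a != LB ->
  endsB u -> zigzag a c (u ++ v) -> zigzag a c u.
Proof.
move=> cB aB; elim/seq_step2_ind: u => // [x|x y u IH] /=.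
  by move=> /eqP->; case: v => // y v /=; case/andP; rewrite eq_sym (negbTE aB).
move=> E /andP[-> /=]; case: eqP => //= yc; apply: IH.
by case: u E => [|z u] //=; rewrite yc (negbTE cB).
Qed.

Lemma wordH_cat u v : wordH u -> wordH' v -> wordH (u ++ v).
Proof.
move=> /andP[Eu Zu] /orP[/eqP->|/andP[Ev _]]; first by rewrite cats0 /wordH Eu.
rewrite /wordH endsB_cat //=.
by case/orP: Zu => /zigzag_cat->; rewrite ?orbT.
Qed.

Lemma wordH'_cat u v : wordH' u -> wordH' v -> wordH' (u ++ v).
Proof.
move=> /orP[/eqP-> //|Hu Hv]; by rewrite /wordH' wordH_cat ?orbT.
Qed.

(** As a suffix of [x], a nonempty [s] ends in [B]; as a prefix of [z] ending in [B], it already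
    contains the whole zigzag prefix of [z]. *)
Lemma wordH'_stable s x y t z : wordH' x -> wordH' z ->
  x = y ++ s -> z = s ++ t -> wordH' s.
Proof.
move=> Hx Hz xs zs; case: (eqVneq s [::]) => [-> //|/eqP s0].
have Es : endsB s.
  case/orP: Hx => [/eqP x0|/andP[Ex _]].
    move: xs; rewrite x0 => /esym/(congr1 size)/eqP.
    by rewrite size_cat addn_eq0 => /andP[_ /eqP/size0nil].
  by apply: (@endsB_catr y) => //; rewrite -xs; exact: Ex.
case/orP: Hz => [/eqP z0|/andP[_ Zz]].
  by move: zs; rewrite z0; case: (s) s0.
rewrite /wordH' /wordH Es; apply/orP; right=> /=; move: Zz; rewrite zs.
by case/orP=> /zigzag_endsB-> //; rewrite orbT.
Qed.

(** * Matching the products that define [H] with words *)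

Lemma ev_nseq k l : ev (nseq k l) = lmat l ^+ k.
Proof. by elim: k => //= k ->; rewrite exprS. Qed.

Definition zz k (a c : letter) := flatten (nseq k [:: a; c]).

Lemma ev_zz k a c : ev (zz k a c) = (lmat a *m lmat c) ^+ k.
Proof. by elim: k => //= k IH; rewrite -/(zz k a c) IH exprS mulmxA. Qed.

Lemma zigzag_zz k a c w : zigzag a c w -> zigzag a c (zz k a c ++ w).
Proof. by move=> Zw; elim: k => //= k IH; rewrite !eqxx /= -/(zz k a c). Qed.

Lemma zigzag_decomp a c w : zigzag a c w ->
  exists k b u, b <> c /\ w = zz k a c ++ [:: a, b & u].
Proof.
elim/seq_step2_ind: w => // x y w IH /= /andP[/eqP->].
case: (eqVneq y c) => [-> /= /IH[k [b [u [bc ->]]]]|/eqP yc _].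
  by exists k.+1, b, u.
by exists 0%N, y, w.
Qed.

(** The last two rows of [inH] are this form with [k > 0]; at [k = 0] it gives the products of the
    first two rows. *)
Definition zigzag_form (a c : letter) (k : nat) (N M : 'M[int]_3) : Prop :=
  let Z := (lmat a *m lmat c) ^+ k in
  [\/ M = Z *m lmat a ^+ 2 *m N *m matB, M = Z *m lmat a *m matB *m N *m matB
    | M = Z *m lmat a *m matB].

Lemma zigzag_form_ev a c k n M : a != c -> c != LB -> zigzag_form a c k (ev n) M ->
  exists w, [/\ endsB w, zigzag a c w & M = ev w].
Proof.
move=> ac cB; have Bc : LB != c by rewrite eq_sym.
have E u : ev (u ++ [:: LB]) = ev u *m matB by rewrite ev_cat ev1.
have EB u : endsB (u ++ [:: LB]) by exact: endsB_cat.
case=> ->.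
- exists (((zz k a c ++ nseq 2 a) ++ n) ++ [:: LB]); split=> //.
    by rewrite -!catA; apply: zigzag_zz; rewrite /= eqxx (negbTE ac).
  by rewrite E !ev_cat ev_zz ev_nseq.
- exists ((((zz k a c ++ [:: a]) ++ [:: LB]) ++ n) ++ [:: LB]); split=> //.
    by rewrite -!catA; apply: zigzag_zz; rewrite /= eqxx (negbTE Bc).
  by rewrite E !ev_cat ev_zz !ev1.
- exists ((zz k a c ++ [:: a]) ++ [:: LB]); split=> //.
    by rewrite -!catA; apply: zigzag_zz; rewrite /= eqxx (negbTE Bc).
  by rewrite E !ev_cat ev_zz !ev1.
Qed.

(** The letter that breaks the alternation is [a] or [B]. If nothing follows it, it ends the word
    and so is [B]; otherwise the rest supplies [N] and the final [B]. *)
Lemma ev_zigzag_form a c w : (forall b, b <> c -> b = a \/ b = LB) ->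
  endsB w -> zigzag a c w -> exists k n, zigzag_form a c k (ev n) (ev w).
Proof.
move=> abc Ew /zigzag_decomp[k [b [u [/abc ab wE]]]].
rewrite {w}wE in Ew *; exists k.
have Eu : u <> [::] -> exists n, u = n ++ [:: LB].
  move=> u0; apply: endsB_rcons.
  by apply: (@endsB_catr (zz k a c ++ [:: a; b])) => //; rewrite -catA.
case: (u =P [::]) => [u0|/Eu[n un]].
  exists [::]; rewrite u0 in Ew *; constructor 3.
  have bB : b = LB.
    have /= /eqP // : endsB [:: b].
    by apply: (@endsB_catr (zz k a c ++ [:: a])) => //; rewrite -catA.
  by rewrite bB ev_cat ev_zz /= mulmx1 !mulmxA.
exists n; rewrite un; case: ab => ->; [constructor 1|constructor 2].
  rewrite (_ : _ ++ _ = ((zz k a c ++ nseq 2 a) ++ n) ++ [:: LB]); last by rewrite -!catA.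
  by rewrite !ev_cat ev_zz ev_nseq ev1.
by rewrite ev_cat ev_zz /= ev_cat ev1 !mulmxA.
Qed.

Lemma inH_word M : inH M -> exists2 w, wordH w & M = ev w.
Proof.
case=> N [k [/inG_ev[n ->] [k0 MH]]].
suff [w [Ew Zw ->]] : exists w,
    [/\ endsB w, zigzag LA LC w || zigzag LC LA w & M = ev w].
  by exists w; rewrite // /wordH Ew.
have form a c j : a != c -> c != LB ->
    zigzag LA LC =1 zigzag a c \/ zigzag LC LA =1 zigzag a c ->
    zigzag_form a c j (ev n) M ->
    exists w, [/\ endsB w, zigzag LA LC w || zigzag LC LA w & M = ev w].
  move=> ac cB zE /(zigzag_form_ev _ _ _ _ _ ac cB)[w [Ew Zw ->]]; exists w; split=> //.
  by case: zE => ->; rewrite Zw ?orbT.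
(* After the first letter comes [a] again or [B], so the alternation breaks at once. *)
have pow a : a != LB ->
    exists w, [/\ endsB w, zigzag LA LC w || zigzag LC LA w & lmat a ^+ k *m matB = ev w].
  move=> aB; exists (nseq k a ++ [:: LB]); split; first exact: endsB_cat.
    by case: a aB => // _; case: (k) k0 => // -[].
  by rewrite ev_cat ev1 ev_nseq.
case: MH => MH.
- case: MH => ME; [|by rewrite ME; exact: (pow LA)|].
    by apply: (form LA LC 0%N) => //; [left|constructor 1; rewrite expr0 mul1mx].
  by apply: (form LA LC 0%N) => //; [left|constructor 2; rewrite expr0 mul1mx].
- case: MH => ME; [|by rewrite ME; exact: (pow LC)|].
    by apply: (form LC LA 0%N) => //; [right|constructor 1; rewrite expr0 mul1mx].
  by apply: (form LC LA 0%N) => //; [right|constructor 2; rewrite expr0 mul1mx].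
- by apply: (form LA LC k) => //; left.
- by apply: (form LC LA k) => //; right.
Qed.

Lemma word_inH w : wordH w -> inH (ev w).
Proof.
case/andP=> Ew /orP[] Zw.
- have [|k [n F]] := ev_zigzag_form LA LC w _ Ew Zw; first by case; [left|right|].
  have Gn : inG (ev n) by apply/inG_ev; exists n.
  case: k F => [|k] F; last by exists (ev n), k.+1; do 2!split=> //; constructor 3.
  (* At [k = 0] the third form is [A B], which is [A ^ k B] with exponent 1; hence the witness. *)
  exists (ev n), 1%N; do 2!split=> //; constructor 1.
  case: F => ->; rewrite expr0 mul1mx; [by constructor 1|by constructor 3|by constructor 2].
- have [|k [n F]] := ev_zigzag_form LC LA w _ Ew Zw; first by case; [|right|left].
  have Gn : inG (ev n) by apply/inG_ev; exists n.
  case: k F => [|k] F; last by exists (ev n), k.+1; do 2!split=> //; constructor 4.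
  exists (ev n), 1%N; do 2!split=> //; constructor 2.
  case: F => ->; rewrite expr0 mul1mx; [by constructor 1|by constructor 3|by constructor 2].
Qed.

Lemma inH'_ev M : inH' M <-> exists2 w, wordH' w & M = ev w.
Proof.
split=> [[/inH_word[w Hw ->]|->]|[w /orP[/eqP->|Hw] ->]].
- by exists w; rewrite // /wordH' Hw orbT.
- by exists [::].
- by right.
- by left; apply: word_inH.
Qed.

(** * The tree of Pythagorean triples *)

Definition lact (l : letter) (t : triple) : triple :=
  let: (x, y, z) := t in
  match l with
  | LA => (x - 2 * y + 2 * z, 2 * x - y + 2 * z, 2 * x - 2 * y + 3 * z)
  | LB => (x + 2 * y + 2 * z, 2 * x + y + 2 * z, 2 * x + 2 * y + 3 * z)
  | LC => (- x + 2 * y + 2 * z, - 2 * x + y + 2 * z, - 2 * x + 2 * y + 3 * z)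
  end.

Definition act (w : seq letter) : triple := foldr lact (1, 0, 1) w.

Lemma lmat_tri l t : lmat l *m tri t = tri (lact l t).
Proof.
case: t => [[x y] z]; apply/matrixP => i j; rewrite !mxE !big_ord_recl big_ord0.
rewrite /= /lift /=.
by case: l; case: i => [[|[|[|i]]] Hi] //=; rewrite !mxE /=; ring.
Qed.

Lemma ev_v101 w : ev w *m v101 = tri (act w).
Proof. by elim: w => [|l w IH] /=; rewrite ?mul1mx // -mulmxA IH lmat_tri. Qed.

Lemma tri_inj : injective tri.
Proof.
move=> [[x y] z] [[x' y'] z'] /colP E.
have := E (inord 0); have := E (inord 1); have := E (inord 2).
by rewrite !mxE !inordK //= => -> -> ->.
Qed.

(* Coprimality is stated as a Bézout identity because that form is visibly
   invariant under unimodular substitutions. *)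
Definition primitive_triple (t : triple) : Prop :=
  let: (x, y, z) := t in
  [/\ [/\ 0 < x, 0 < y & 0 < z], (2 %| y)%Z, x ^+ 2 + y ^+ 2 = z ^+ 2 &
      exists a b c, a * x + b * y + c * z = 1].

Lemma gcdz3P (x y z : int) :
  gcdz (gcdz x y) z = 1 <-> exists a b c, a * x + b * y + c * z = 1.
Proof.
split=> [g1|[a [b [c E]]]].
  have [a [b E1]] := Bezoutz x y; have [c [d E2]] := Bezoutz (gcdz x y) z.
  by exists (c * a), (c * b), d; rewrite -g1 -E2 -E1; ring.
have : (gcdz (gcdz x y) z %| (a * x + b * y + c * z)%R)%Z.
  rewrite !rpredD // dvdz_mull //.
  - exact: dvdz_trans (dvdz_gcdl _ _) (dvdz_gcdl _ _).
  - exact: dvdz_trans (dvdz_gcdl _ _) (dvdz_gcdr _ _).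
  - exact: dvdz_gcdr.
by rewrite E dvdz1 /gcdz !absz_nat => /eqP->.
Qed.

Lemma primitive_triple_lt {x y z} : primitive_triple (x, y, z) ->
  [/\ x < z, y < z & z < x + y].
Proof. by case=> -[x0 y0 z0] _ E _; split; nia. Qed.


Lemma primitive_lact l t : primitive_triple t -> primitive_triple (lact l t).
Proof.
case: t => [[x y] z] Pt; have [xz yz _] := primitive_triple_lt Pt.
case: Pt => -[x0 y0 z0] /dvdzP[k yE] E [a [b [c Ebez]]].
have Ez : z * z = x * x + y * y by rewrite -!expr2 E.
case: l => /=; split; try (split; lia); try (apply/dvdzP).
- by exists (x - k + z); rewrite yE; ring.
- by lia.
(* The row of coefficients is multiplied by the inverse matrix, which is [J M^T J] with
   [J = diag(1,1,-1)] because [M] preserves [x^2 + y^2 - z^2]. *)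
- by exists (a - 2 * b - 2 * c), (2 * a - b - 2 * c), (- 2 * a + 2 * b + 3 * c);
    rewrite -[RHS]Ebez; ring.
- by exists (x + k + z); rewrite yE; ring.
- by lia.
- by exists (a + 2 * b - 2 * c), (2 * a + b - 2 * c), (- 2 * a - 2 * b + 3 * c);
    rewrite -[RHS]Ebez; ring.
- by exists (- x + k + z); rewrite yE; ring.
- by lia.
- by exists (- a + 2 * b - 2 * c), (- 2 * a + b - 2 * c), (2 * a - 2 * b + 3 * c);
    rewrite -[RHS]Ebez; ring.
Qed.

Lemma primitive_act w : endsB w -> primitive_triple (act w).
Proof.
elim: w => [|l w IH] // Ew; case: w IH Ew => [|m w] IH Ew; last exact/primitive_lact/IH.
move/eqP: Ew => /= ->; split=> //; exists (-1), 1, 0; by [].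
Qed.

(** [A] and [C] are [B] preceded by a sign change of [y] or of [x], so undoing [B] reads the letter
    off the signs. One second coordinate may vanish, to admit the root [(1,0,1)]; if both did, [A]
    and [B] would agree. *)
Lemma lact_inj l l' x y z x' y' z' : 0 < x -> 0 < x' -> 0 < y -> 0 <= y' ->
  lact l (x, y, z) = lact l' (x', y', z') -> l = l' /\ (x, y, z) = (x', y', z').
Proof.
move=> x0 x0' y0 y0' E.
have {E}[E1 E2 E3] : [/\ (lact l (x, y, z)).1.1 = (lact l' (x', y', z')).1.1,
   (lact l (x, y, z)).1.2 = (lact l' (x', y', z')).1.2 &
   (lact l (x, y, z)).2 = (lact l' (x', y', z')).2] by rewrite E.
case: l l' E1 E2 E3 => -[] /= E1 E2 E3; try lia;
  by split=> //; congr (_, _, _); lia.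
Qed.

(** Letters are recovered from the left by [lact_inj]. The final [B] is what makes words unique: [C]
    fixes [(1,0,1)], and [A] and [B] both send it to [(3,4,5)]. *)
Lemma act_inj w w' : endsB w -> endsB w' -> act w = act w' -> w = w'.
Proof.
have ne l l' u : endsB u -> lact l (act u) <> lact l' (1, 0, 1).
  move/primitive_act; case: (act u) => [[x y] z] [[x0 y0 _] _ _ _].
  by case/lact_inj => // _ [_ y00 _]; rewrite y00 in y0.
elim: w w' => [|l [|m w] IH] [|l' [|m' w']] //.
- by move=> /= /eqP-> /eqP->.
- by move=> _ Ew' E; case: (ne l' l (m' :: w') Ew' (esym E)).
- by move=> Ew _ E; case: (ne l l' (m :: w) Ew E).
move=> Ew Ew'; rewrite -[act _]/(lact l (act (m :: w))).
rewrite -[RHS]/(lact l' (act (m' :: w'))).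
have := IH (m' :: w') Ew Ew'.
have := primitive_act (m :: w) Ew; have := primitive_act (m' :: w') Ew'.
case: (act (m :: w)) => [[x y] z]; case: (act (m' :: w')) => [[x' y'] z'].
move=> [[x0' y0' _] _ _ _] [[x0 y0 _] _ _ _] IHw.
by case/(lact_inj _ _ _ _ _ _ _ _ x0 x0' y0 (ltW y0')) => -> /IHw->.
Qed.

(* [A] and [C] exchange the linear forms [z - 2x] and [z - 2y] up to sign, so
   [z - 2x] is invariant under [AC] and [z - 2y] under [CA]. *)
Lemma zigzag_act w : endsB w ->
  (zigzag LA LC w = (2 * (act w).1.1 < (act w).2)) *
  (zigzag LC LA w = (2 * (act w).1.2 < (act w).2)).
Proof.
have pos u : endsB u \/ u = [::] ->
    [/\ 0 < (act u).1.1, 0 <= (act u).1.2, (act u).1.1 <= (act u).2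
      & (act u).1.2 < (act u).2].
  case=> [/primitive_act|-> //]; case: (act u) => [[x y] z] Pu.
  by have [? ? _] := primitive_triple_lt Pu; case: Pu => [[? ? ?] _ _ _]; split=> //; exact: ltW.
elim/seq_step2_ind: w => // [a /eqP/= -> //|a b w IH Ew].
have Ew' : endsB w \/ w = [::] by case: (w) Ew => [|c u] /=; [right|left].
have := pos w Ew'; move: IH.
rewrite /= -/(act w); case: (act w) => [[x y] z] /= IH [x0 y0 xz yz].
(* If [w] is empty then [b] is the last letter, hence [B]; so for any other [b] the induction
   hypothesis applies. *)
have {}IH : b <> LB -> (zigzag LA LC w = (2 * x < z)) * (zigzag LC LA w = (2 * y < z)).
  by move=> bB; apply: IH; case: Ew' Ew => [//|->] /= /eqP.
by case: a b {Ew} IH => -[] IH; rewrite /= ?IH //; split; lia.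
Qed.

(** * Descent of primitive triples to [(3,4,5)] *)

Lemma int_parity (z : int) : exists h, z = 2 * h \/ z = 2 * h + 1.
Proof. by exists (z %/ 2)%Z; lia. Qed.

Lemma primitive_triple_odd {x y z} : primitive_triple (x, y, z) -> ~~ (2 %| x)%Z.
Proof.
case=> _ /dvdzP[k yE] E [a [b [c Ebez]]]; apply/negP => /dvdzP[j xE].
have [h [zE|zE]] := int_parity z.
  have : 2 * (a * j + b * k + c * h) = 1 :> int by rewrite -[RHS]Ebez xE yE zE; ring.
  lia.
have : z * z = 2 * (x * j + y * k) by rewrite -[LHS]expr2 -E !expr2 {2}xE {2}yE; ring.
rewrite {1 2}zE; lia.
Qed.

Lemma pos_unit_int (j m : int) : 0 < j -> j * m = 1 -> j = 1.
Proof.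
move=> j0 jm; have m0 : 0 < m by rewrite -(pmulr_rgt0 m j0) jm.
have : 0 <= (j - 1) * (m - 1) by apply: mulr_ge0; lia.
lia.
Qed.

(** From [(x + y)^2 <= 2 z^2] and [2 < 9/4]; this keeps the hypotenuse positive in the descent. *)
Lemma two_legs_lt {x y z : int} : 0 < z -> z * z = x * x + y * y -> 2 * (x + y) < 3 * z.
Proof.
move=> z0 E; rewrite ltNge; apply/negP => le.
have : (3 * z) * (3 * z) <= (2 * (x + y)) * (2 * (x + y)) by apply: ler_pM; lia.
have : 0 <= (x - y) * (x - y) by rewrite -expr2 sqr_ge0.
have : 0 < z * z by rewrite mulr_gt0.
lia.
Qed.

(** [(s1, s2, z')] is the image under the inverse of [B]. The signs of [s1] and [s2] select the
    letter, and their absolute values are the legs of the parent. *)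
Lemma primitive_descent x y z : primitive_triple (x, y, z) ->
  (x, y, z) = (3, 4, 5) \/
  exists l t, [/\ primitive_triple t, t.2 < z & lact l t = (x, y, z)].
Proof.
move=> Pt; have [xz yz zxy] := primitive_triple_lt Pt.
have x2 := primitive_triple_odd Pt.
case: Pt => -[x0 y0 z0] /dvdzP[k yE] E [a [b [c Ebez]]].
have Ez : z * z = x * x + y * y by rewrite -!expr2 E.
pose s1 := x + 2 * y - 2 * z; pose s2 := 2 * x + y - 2 * z.
pose z' := 3 * z - 2 * x - 2 * y.
have s1N0 : s1 != 0.
  apply: contra x2 => /eqP s10; apply/dvdzP; exists (z - y); rewrite /s1 in s10; lia.
have [s20|s2N0] := eqVneq s2 0; [left | right].
  (* Here the triple is a multiple [j (3,4,5)], and the Bézout identity forces [j = 1]. *)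
  rewrite /s2 in s20.
  have k0 : 0 < k by lia.
  have xE : x = z - k by lia.
  have zE : 2 * z = 5 * k.
    apply: (mulfI (lt0r_neq0 k0)); rewrite xE yE in Ez; lia.
  have [j [kE|kE]] := int_parity k; last lia.
  have zj : z = 5 * j by lia.
  have j1 : j * (3 * a + 4 * b + 5 * c) = 1.
    by rewrite -[RHS]Ebez xE yE zj kE; ring.
  have {j1} : j = 1 by apply: pos_unit_int j1; lia.
  by move=> j1; rewrite xE yE zj kE j1.
have z'0 : 0 < z' by have := two_legs_lt z0 Ez; rewrite /z'; lia.
have z'z : z' < z by rewrite /z'; lia.
have key (e1 e2 : int) : e1 * e1 = 1 -> e2 * e2 = 1 -> 0 < e1 * s1 -> 0 < e2 * s2 ->
    primitive_triple (e1 * s1, e2 * s2, z').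
  move=> e11 e22 p1 p2; split=> //.
  - by apply/dvdzP; exists (e2 * (x + k - z)); rewrite /s2 yE; ring.
  - rewrite !exprMn !expr2 e11 e22 !mul1r /s1 /s2 /z'; lia.
  - exists (e1 * (a + 2 * b + 2 * c)), (e2 * (2 * a + b + 2 * c)), (2 * a + 2 * b + 3 * c).
    rewrite -[RHS]Ebez (_ : _ * _ * (_ * s1) = (e1 * e1) * (a + 2 * b + 2 * c) * s1); last by ring.
    rewrite (_ : _ * _ * (_ * s2) = (e2 * e2) * (2 * a + b + 2 * c) * s2); last by ring.
    by rewrite e11 e22 /s1 /s2 /z'; ring.
have [s1p|s1n] := ltP 0 s1; have [s2p|s2n] := ltP 0 s2.
- exists LB, (1 * s1, 1 * s2, z'); split=> //; first by apply: key; lia.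
  by rewrite /= /s1 /s2 /z'; congr (_, _, _); ring.
- exists LA, (1 * s1, -1 * s2, z'); split=> //; first by apply: key; lia.
  by rewrite /= /s1 /s2 /z'; congr (_, _, _); ring.
- exists LC, (-1 * s1, 1 * s2, z'); split=> //; first by apply: key; lia.
  by rewrite /= /s1 /s2 /z'; congr (_, _, _); ring.
(* Both negative is impossible: as [x^2 = (z - y)(z + y)], the first inequality gives [z + y < 2x];
   the second likewise gives [z + x < 2y], and their sum contradicts [x, y < z]. *)
- rewrite /s1 in s1n s1N0; rewrite /s2 in s2n s2N0.
  have l1 : x < 2 * (z - y) by lia.
  have l2 : y < 2 * (z - x) by lia.
  have : z + y < 2 * x.
    rewrite -(ltr_pM2l (_ : 0 < z - y)); last lia.
    have : x * x < 2 * (z - y) * x by rewrite ltr_pM2r.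
    lia.
  have : z + x < 2 * y.
    rewrite -(ltr_pM2l (_ : 0 < z - x)); last lia.
    have : y * y < 2 * (z - x) * y by rewrite ltr_pM2r.
    lia.
  lia.
Qed.

Lemma primitive_word t : primitive_triple t -> exists2 w, endsB w & act w = t.
Proof.
have [n] := ubnP `|t.2|%N; elim: n t => // n IH [[x y] z] /= zn Pt.
case: (primitive_descent _ _ _ Pt) => [->|[l [t [Pt' tz <-]]]].
  by exists [:: LB].
have t0 : 0 < t.2 by move: Pt'; case: (t) => [[? ?] ?] [[]].
have [|w Ew <-] := IH t _ Pt'; first by lia.
by exists (l :: w); case: w Ew.
Qed.

Lemma inP_primitive x y z : inP (x, y, z) <->
  (x, y, z) = (1, 0, 1) \/ primitive_triple (x, y, z) /\ (2 * x < z \/ 2 * y < z).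
Proof.
have min_lt : 2 * Num.min x y < z <-> 2 * x < z \/ 2 * y < z.
  by case: leP => xy; split; lia.
rewrite /inP /primitive_triple; split=> [[->|[? ? /gcdz3P ? ? /min_lt]]|];
  first by left.
  by move=> ?; right.
by case=> [->|[[? ? ? /gcdz3P ?] /min_lt ?]]; [left|right].
Qed.

Lemma act_inP w : wordH' w -> inP (act w).
Proof.
case/orP=> [/eqP->|/andP[Ew]]; first by left.
rewrite !(zigzag_act _ Ew).
have := primitive_act _ Ew; case: (act w) => [[x y] z] Pw /= xyz.
by apply/inP_primitive; right; split=> //; apply/orP.
Qed.

Lemma inP_act t : inP t -> exists2 w, wordH' w & act w = t.
Proof.
case: t => [[x y] z] /inP_primitive[->|[/primitive_word[w Ew tw] xyz]].
  by exists [::].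
exists w => //; rewrite /wordH' /wordH Ew !(zigzag_act _ Ew) tw /=.
by apply/orP; right; apply/orP.
Qed.

Lemma wordH'_act_inj w w' : wordH' w -> wordH' w' -> act w = act w' -> w = w'.
Proof.
have ne u : endsB u -> act u <> (1, 0, 1).
  move/primitive_act; case: (act u) => [[x y] z] [[_ y0 _] _ _ _] [_ y00 _].
  by rewrite y00 in y0.
case/orP=> [/eqP->|/andP[Ew _]]; case/orP=> [/eqP->|/andP[Ew' _]] //.
- by move=> E; case: (ne w' Ew' (esym E)).
- by move=> E; case: (ne w Ew E).
exact: act_inj.
Qed.

(** * Well-rounded lattices *)

(** The change of basis has integer entries; used in both directions, this makes the lattice
    determinant well defined. *)
Lemma basis_det_dvd L u v u' v' : is_basis L u v -> is_basis L u' v' ->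
  (det2 u v %| det2 u' v')%Z.
Proof.
move=> [_ Luv] [_ Luv'].
have /Luv[m [n ->]] : L u' by apply/Luv'; exists 1, 0; case: (u') => ? ? /=; congr (_, _); ring.
have /Luv[m' [n' ->]] : L v' by apply/Luv'; exists 0, 1; case: (v') => ? ? /=; congr (_, _); ring.
by apply/dvdzP; exists (m * n' - n * m'); rewrite /det2 /=; ring.
Qed.

Lemma lat_det_uniq L d d' : lat_det L d -> lat_det L d' -> d = d'.
Proof.
move=> [u [v [B ->]]] [u' [v' [B' ->]]].
have := basis_det_dvd _ _ _ _ _ B B'; have := basis_det_dvd _ _ _ _ _ B' B.
rewrite !dvdzE => d1 d2; have /eqP E : (`|det2 u v|%N == `|det2 u' v'|%N) by rewrite eqn_dvd d1 d2.
lia.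
Qed.

Lemma lat_min2_uniq L m m' : lat_min2 L m -> lat_min2 L m' -> m = m'.
Proof.
move=> [[x [Lx [x0 <-]]] minx] [[y [Ly [y0 <-]]] miny].
by apply/le_anti; rewrite minx ?miny.
Qed.

Lemma sin_theta_uniq L s s' : sin_theta_is L s -> sin_theta_is L s' -> s = s'.
Proof.
move=> [d [m [Ld Lm ->]]] [d' [m' [Ld' Lm' ->]]].
by rewrite (lat_det_uniq _ _ _ Ld Ld') (lat_min2_uniq _ _ _ Lm Lm').
Qed.

(** Two vectors of length [q] at an angle with cosine [r / q] in [[0, 1/2]] form a reduced basis, so
    they are minimal and the sine is [p / q]. *)
Lemma Ccls_span (p q r : int) : 0 < p -> 0 < q -> 0 <= r -> 2 * r <= q ->
  r ^+ 2 = q ^+ 2 - p ^+ 2 -> Ccls p q (span2 (q, 0) (r, p)).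
Proof.
move=> p0 q0 r0 rq E; set L := span2 _ _.
have Ez : r * r + p * p = q * q by rewrite -!expr2 E; ring.
have det : det2 (q, 0) (r, p) = q * p by rewrite /det2 /=; ring.
have basis : is_basis L (q, 0) (r, p) by split=> //; rewrite det mulf_neq0 ?gt_eqF.
have Lq : L (q, 0) by exists 1, 0 => /=; congr (_, _); ring.
have Lr : L (r, p) by exists 0, 1 => /=; congr (_, _); ring.
have norm_q : norm2 (q, 0) = q * q by rewrite /norm2 /=; ring.
have norm_r : norm2 (r, p) = q * q by rewrite /norm2 /= !expr2.
have q_neq0 : ((q, 0) : pt) != (0, 0) by rewrite xpair_eqE gt_eqF.
have minL : lat_min2 L (q * q).
  split=> [|x [a [b -> {x}]] /= x0]; first by exists (q, 0).
  rewrite /norm2 /=.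
  have -> : (a * q + b * r) ^+ 2 + (a * 0 + b * p) ^+ 2 =
      q * (q * (a * a + b * b) + 2 * r * (a * b)).
    by transitivity (a * a * (q * q) + 2 * a * b * q * r + b * b * (r * r + p * p));
       [|rewrite Ez]; ring.
  rewrite ler_pM2l //.
  (* Half of [a^2 + b^2] bounds [|ab|], so the difference is a positive integer. *)
  have ab : 1 <= a * a + b * b - `|a * b|.
    have a2b2 : 0 < a * a + b * b.
      rewrite lt0r addr_ge0 -?expr2 ?sqr_ge0 // andbT paddr_eq0 ?sqr_ge0 // !sqrf_eq0.
      by apply: contraNN x0 => /andP[/eqP-> /eqP->]; rewrite !mul0r addr0.
    have : 0 <= (a - b) * (a - b) by rewrite -expr2 sqr_ge0.
    have : 0 <= (a + b) * (a + b) by rewrite -expr2 sqr_ge0.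
    lia.
  have : - (q * `|a * b|) <= 2 * r * (a * b).
    have : 0 <= (q - 2 * r) * `|a * b| by rewrite mulr_ge0 // subr_ge0.
    have : 0 <= r * (`|a * b| + a * b) by rewrite mulr_ge0 //; lia.
    lia.
  have : q * 1 <= q * (a * a + b * b - `|a * b|) by rewrite ler_pM2l.
  lia.
split; first split; first by exists (q, 0), (r, p).
  exists (q * q), (q, 0), (r, p); split=> //.
  by case: basis.
exists (q * p), (q * q); split=> //.
  by exists (q, 0), (r, p); split=> //; rewrite det ger0_norm // mulr_ge0 // ltW.
have qR : (q%:~R : rat) != 0 by rewrite intr_eq0 gt_eqF.
by rewrite !rmorphM /=; field.
Qed.

(** * From ratios in lowest terms to triples *)

Lemma coprime_ratio (p q p' q' : int) : 0 < p -> 0 < q -> 0 < p' -> 0 < q' ->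
  coprimez p q -> coprimez p' q' -> p%:~R / q%:~R = p'%:~R / q'%:~R :> rat ->
  p = p' /\ q = q'.
Proof.
move=> p0 q0 p0' q0' co co' /eqP.
have qN : q%:~R != 0 :> rat by rewrite intr_eq0 gt_eqF.
have qN' : q'%:~R != 0 :> rat by rewrite intr_eq0 gt_eqF.
rewrite eqr_div // -!intrM eqr_int => /eqP E.
have d1 : (q %| q')%Z.
  by rewrite -(Gauss_dvdzr q' (m := q) (n := p)) ?E 1?coprimez_sym // dvdz_mull.
have d2 : (q' %| q)%Z.
  by rewrite -(Gauss_dvdzr q (m := q') (n := p')) -?E 1?coprimez_sym // dvdz_mull.
have qq' : q = q'.
  move: d1 d2; rewrite !dvdzE => d1 d2.
  have /eqP : (`|q|%N == `|q'|%N) by rewrite eqn_dvd d1 d2.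
  lia.
split=> //; apply: (mulIf (lt0r_neq0 q0')); by rewrite E qq'.
Qed.

(** Through [r^2 = q^2 - p^2], the bound [sqrt(3)/2 < p/q] becomes [2r < q]: the reducedness used by
    [Ccls_span] and the short leg required by [inP]. *)
Lemma inS_facts {p q : int} : inS p q ->
  [/\ 0 < p /\ 0 < q, coprimez p q &
      exists r, [/\ 0 <= r, 2 * r < q & r ^+ 2 = q ^+ 2 - p ^+ 2]].
Proof.
case=> [[-> ->]|[[p0 q0] co pq _ [r rE]]]; first by split=> //; exists 0.
split=> //; exists `|r|; split=> //; last by rewrite -normrX ger0_norm ?sqr_ge0.
rewrite -ltr_sqr ?nnegrE ?mulr_ge0 ?(ltW q0) //.
by rewrite exprMn -normrX ger0_norm ?sqr_ge0 // rE; lia.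
Qed.

Lemma Ccls_inj p q p' q' : inS p q -> inS p' q' -> Ccls p q = Ccls p' q' ->
  p = p' /\ q = q'.
Proof.
move=> /inS_facts[[p0 q0] co [r [r0 rq rE]]] /inS_facts[[p0' q0'] co' _] E.
have L1 := Ccls_span p q r p0 q0 r0 (ltW rq) rE.
have L2 := L1; rewrite E in L2.
by apply: coprime_ratio => //; apply: sin_theta_uniq L1.2 L2.2.
Qed.

Lemma sqrt_uniq (r r' : int) : 0 <= r -> 0 <= r' -> r ^+ 2 = r' ^+ 2 -> r = r'.
Proof. by move=> r0 r0' /eqP; rewrite eqrXn2 // => /eqP. Qed.

Lemma psi_val_inP p q r : inS p q -> 0 <= r -> r ^+ 2 = q ^+ 2 - p ^+ 2 ->
  inP (psi_val p q r).
Proof.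
move=> S r0 rE; have [[p0 q0] co [r' [r0' rq]]] := inS_facts S.
rewrite -rE => /sqrt_uniq -/(_ r0' r0) E; subst r'.
case: S => [[p1 q1]|[_ _ _ pq _]].
  have -> : r = 0 by lia.
  by rewrite p1 q1; left.
have rp : 0 < r by rewrite lt0r r0 andbT; apply: contraTneq pq => r00; nia.
have Ez : r * r + p * p = q * q by rewrite -!expr2 rE; ring.
have [[a b] /= bez] := coprimezP _ _ co.
rewrite /psi_val; case: ifP => [p2|p2]; apply/inP_primitive; right; split; [|by left| |by right].
  split=> //.
  by exists 0, a, b; rewrite -[RHS]bez; ring.
split=> //; [|by rewrite !expr2 addrC| by exists a, 0, b; rewrite -[RHS]bez; ring].
(* For odd [p], an odd [r] would make [q^2] congruent to 2 modulo 4. *)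
have [h [hE|hE]] := int_parity r; first by apply/dvdzP; exists h; rewrite hE; ring.
have [h1 [hE1|hE1]] := int_parity p.
  by move: p2; rewrite hE1 dvdz_mulr.
have [h2 [hE2|hE2]] := int_parity q; rewrite hE hE1 hE2 in Ez; lia.
Qed.

(** Equal triples have equal [q]. If [p] and [p'] had different parities, then [p = r'], but
    [2 r' < q] while [p] exceeds [q sqrt(3)/2]. *)
Lemma psi_val_inj p q r p' q' r' : inS p q -> inS p' q' -> 0 <= r -> 0 <= r' ->
  r ^+ 2 = q ^+ 2 - p ^+ 2 -> r' ^+ 2 = q' ^+ 2 - p' ^+ 2 ->
  psi_val p q r = psi_val p' q' r' -> p = p' /\ q = q'.
Proof.
move=> /inS_facts[[p0 q0] _ [s [s0 sq sE]]] /inS_facts[[p0' q0'] _ [s' [s0' sq' sE']]].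
move=> r0 r0'; rewrite -sE -sE' => /sqrt_uniq -/(_ r0 s0) -> /sqrt_uniq -/(_ r0' s0') ->.
rewrite /psi_val; case: ifP => _; case: ifP => _ [] // E1 E2 E3; rewrite -?E3 // in sE sE' sq'; nia.
Qed.

(** The leg below [z / 2] becomes [r] and the other one [p]; since [x] is odd and [y] even,
    [psi_val] restores their order. *)
Lemma inP_psi_val t : inP t -> exists p q r,
  [/\ inS p q, 0 <= r, r ^+ 2 = q ^+ 2 - p ^+ 2 & psi_val p q r = t].
Proof.
case: t => [[x y] z] /inP_primitive[->|[Pt small]].
  by exists 1, 1, 0; split=> //; left.
have [xz yz _] := primitive_triple_lt Pt; have x2 := primitive_triple_odd Pt.
case: Pt => -[x0 y0 z0] y2 E bez.
have Ez : z * z = x * x + y * y by rewrite -!expr2 E.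
have co (p r : int) : p * p + r * r = z * z ->
    (exists a b c, a * p + b * r + c * z = 1) -> coprimez p z.
  move=> Epr [a [b [c E1]]].
  (* square the Bézout identity: [r ^ 2] lies in the ideal [(p, z)] *)
  apply/coprimezP.
  exists (- (b * b) * p + 2 * a - a * (a * p + c * z),
          (b * b) * z + 2 * c - c * (a * p + c * z)) => /=.
  have br : b * r = 1 - (a * p + c * z) by rewrite -E1; ring.
  transitivity (b * b * (z * z - p * p) + 2 * (a * p + c * z) - (a * p + c * z) * (a * p + c * z)).
    by ring.
  rewrite -Epr (_ : b * b * _ = (b * r) * (b * r)); last by ring.
  by rewrite br; ring.
case: (boolP (2 * x < z)) => [xs|xb].
  exists y, z, x; split; rewrite ?(ltW x0) //; last by rewrite /psi_val y2.
    right; split=> //.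
    - apply: (co y x); first by rewrite Ez addrC.
      by have [a [b [c <-]]] := bez; exists b, a, c; ring.
    - nia.
    - by exists x; rewrite -E; ring.
  by rewrite -E; ring.
have ys : 2 * y < z by case: small => // xs; rewrite xs in xb.
exists x, z, y; split; rewrite ?(ltW y0) //.
- right; split=> //.
  - exact: (co x y).
  - nia.
  - by exists y; rewrite -E; ring.
- by rewrite -E; ring.
by rewrite /psi_val (negbTE x2).
Qed.

(** * The bijections and the operation *)

Definition psi_spec (X : classC2) (t : triple) : Prop :=
  exists p q r, [/\ inS p q, sval X = Ccls p q, 0 <= r,
    r ^+ 2 = q ^+ 2 - p ^+ 2 & t = psi_val p q r].

Lemma psi_spec_ex X : exists t, psi_spec X t.
Proof.
case: X => X [p [q [S XE]]]; have [_ _ [r [r0 _ rE]]] := inS_facts S.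
by exists (psi_val p q r), p, q, r.
Qed.

(** A class only asserts that some [p] and [q] exist, so the triple is chosen by [epsilon]; [psiE]
    shows that the class determines it. *)
Definition psi (X : classC2) : triple := epsilon (inhabits (0, 0, 0)) (psi_spec X).

Lemma psiP X : psi_spec X (psi X).
Proof. exact: epsilon_spec (psi_spec_ex X). Qed.

Lemma psiE X p q r : inS p q -> sval X = Ccls p q -> 0 <= r ->
  r ^+ 2 = q ^+ 2 - p ^+ 2 -> psi X = psi_val p q r.
Proof.
move=> S XE r0 rE; have [p' [q' [r' [S' XE' r0' rE' ->]]]] := psiP X.
have [pp qq] : p = p' /\ q = q' by apply: Ccls_inj => //; rewrite -XE.
subst p' q'; congr psi_val; apply: sqrt_uniq => //; by rewrite rE.
Qed.

Lemma psi_inP X : inP (psi X).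
Proof. by have [p [q [r [S _ r0 rE ->]]]] := psiP X; apply: psi_val_inP. Qed.

Lemma psi_inj X Y : psi X = psi Y -> X = Y.
Proof.
have [p [q [r [S XE r0 rE ->]]]] := psiP X.
have [p' [q' [r' [S' YE r0' rE' ->]]]] := psiP Y.
move/psi_val_inj => -/(_ S S' r0 r0' rE rE')[pp qq].
case: X Y XE YE => [X PX] [Y PY] /= XE YE.
have {p q r S r0 rE p' q' r' S' r0' rE' XE YE pp qq} XY : X = Y by rewrite XE YE pp qq.
(* Elements of [classC2] carry a proof of membership besides the predicate. *)
by subst Y; rewrite (proof_irrelevance _ PX PY).
Qed.

Lemma psi_surj t : inP t -> exists X, psi X = t.
Proof.
move=> /inP_psi_val[p [q [r [S r0 rE <-]]]].
exists (exist _ (Ccls p q) (ex_intro _ p (ex_intro _ q (conj S erefl)))).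
exact: psiE.
Qed.

Definition word_of (t : triple) : seq letter :=
  epsilon (inhabits [::]) (fun w => wordH' w /\ act w = t).

Lemma word_ofP t : inP t -> wordH' (word_of t) /\ act (word_of t) = t.
Proof. move=> /inP_act[w Hw wt].
exact: (epsilon_spec _ (fun w => wordH' w /\ act w = t) (ex_intro _ w (conj Hw wt))). Qed.

Lemma act_word_of w : wordH' w -> word_of (act w) = w.
Proof.
by move=> Hw; have [Hw' E] := word_ofP _ (act_inP _ Hw); apply: wordH'_act_inj.
Qed.

Definition phi (t : triple) : 'M[int]_3 := ev (word_of t).

(** Coding a class by its word embeds [classC2] in the free monoid on the letters; this is the map
    [th] of the stable submonoid section. *)
Definition theta (X : classC2) : seq letter := word_of (psi X).

Lemma thetaP X : wordH' (theta X) /\ act (theta X) = psi X.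
Proof. exact/word_ofP/psi_inP. Qed.

Lemma theta_inj : injective theta.
Proof.
by move=> X Y E; apply: psi_inj; rewrite -(thetaP X).2 -(thetaP Y).2 E.
Qed.

Lemma theta_surj w : wordH' w -> exists X, theta X = w.
Proof.
move=> Hw; have [X XE] := psi_surj _ (act_inP _ Hw).
by exists X; rewrite /theta XE act_word_of.
Qed.

Definition class_of (w : seq letter) : classC2 :=
  epsilon (inhabits C11) (fun X => theta X = w).

Lemma class_ofK w : wordH' w -> theta (class_of w) = w.
Proof. move=> /theta_surj; exact: (epsilon_spec _ (fun X => theta X = w)). Qed.

(** By [ev_cat], concatenating words multiplies their matrices, so this is the operation of the
    theorem. *)
Definition cmul (X Y : classC2) : classC2 := class_of (theta X ++ theta Y).

Lemma thetaM X Y : theta (cmul X Y) = theta X ++ theta Y.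
Proof.
by apply: class_ofK; apply: wordH'_cat; [case: (thetaP X)|case: (thetaP Y)].
Qed.

Lemma theta1 : theta C11 = [::].
Proof.
by rewrite /theta (psiE C11 1 1 0) //; [exact: (act_word_of [::]) | exact: inS11].
Qed.

Lemma cmul_monoid : is_monoid cmul C11.
Proof.
split=> [x y z|x]; first by apply: theta_inj; rewrite !thetaM catA.
by split; apply: theta_inj; rewrite !thetaM theta1 ?cats0.
Qed.

Lemma theta_stable x y z t s : theta x = theta y ++ s -> theta z = s ++ theta t ->
  exists y', theta y' = s.
Proof.
move=> xs zs; apply: theta_surj; apply: wordH'_stable xs zs.
  exact: (thetaP x).1.
exact: (thetaP z).1.
Qed.

Lemma wordH_powAB k : wordH' (nseq k.+1 LA ++ [:: LB]).
Proof.
rewrite /wordH' /wordH endsB_cat //=.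
by case: k.
Qed.

(* Every element of [H] ends in [B], and [A^k B] contains only one [B]. *)
Lemma irreducible_powAB k : irreducible cmul C11 (class_of (nseq k.+1 LA ++ [:: LB])).
Proof.
have E := class_ofK _ (wordH_powAB k); split.
  by move/(congr1 theta); rewrite E theta1.
move=> y z /(congr1 theta); rewrite E thetaM => {}E.
have [/orP[/eqP y0|/andP[/endsB_rcons[u yu] _]] _] := thetaP y.
  by left; apply: theta_inj; rewrite y0 theta1.
have [/orP[/eqP z0|/andP[/endsB_rcons[v zv] _]] _] := thetaP z.
  by right; apply: theta_inj; rewrite z0 theta1.
move: E; rewrite yu zv => /(congr1 (count_mem LB)).
by rewrite !count_cat count_nseq /=; lia.
Qed.

Lemma cmul_not_fg : ~ finitely_generated cmul C11.
Proof.
apply: (@not_finitely_generated _ _ _ cmul_monoid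
  (fun k => class_of (nseq k.+1 LA ++ [:: LB]))); last exact: irreducible_powAB.
move=> k k' /(congr1 theta); rewrite !class_ofK ?wordH_powAB // => /(congr1 size).
by rewrite !size_cat !size_nseq /= !addn1 => -[].
Qed.

Theorem theorem1p1 :
  exists (psi : classC2 -> triple) (phi : triple -> 'M[int]_3)
         (mul : classC2 -> classC2 -> classC2),
  (
   (* psi(C(p,q)) = (sqrt(q^2-p^2), p, q) or (p, sqrt(q^2-p^2), q) *)
   (forall (X : classC2) (p q r : int), inS p q -> sval X = Ccls p q ->
       0 <= r -> r ^+ 2 = q ^+ 2 - p ^+ 2 -> psi X = psi_val p q r) /\
   (* psi : C_2 -> P is a bijection *)
   ((forall X, inP (psi X)) /\ (forall X Y, psi X = psi Y -> X = Y) /\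
   (forall t, inP t -> exists X, psi X = t)) /\
   (* phi(t) is the unique element M of H' with M (1,0,1)^t = t *)
   ((forall t, inP t -> inH' (phi t) /\ phi t *m v101 = tri t) /\
   (forall t M, inP t -> inH' M -> M *m v101 = tri t -> M = phi t)) /\
   (* phi : P -> H' is a bijection *)
   ((forall t1 t2, inP t1 -> inP t2 -> phi t1 = phi t2 -> t1 = t2) /\
   (forall M, inH' M -> exists t, inP t /\ phi t = M)) /\
   (* the operation * *)
   (forall X Y, tri (psi (mul X Y)) = phi (psi X) *m phi (psi Y) *m v101) /\
   (* (C_2, * ) is a free, non-commutative, infinitely generated monoid with identity C(1,1) *)
   [/\ is_monoid mul C11,
       exists Bs, free_basis mul C11 Bs,
       exists X Y, mul X Y <> mul Y X &
       ~ finitely_generated mul C11] /\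
   (* phi o psi : (C_2, * ) -> H' is a monoid isomorphism *)
   [/\ forall X Y, phi (psi (mul X Y)) = phi (psi X) *m phi (psi Y),
       phi (psi C11) = 1%:M,
       forall X, inH' (phi (psi X)),
       forall X Y, phi (psi X) = phi (psi Y) -> X = Y &
       forall M, inH' M -> exists X, phi (psi X) = M] /\
   (* Cayley digraph w.r.t. a free generating set *)
   (forall Bs, free_basis mul C11 Bs -> cayley_regular_rooted_infinite_tree mul C11 Bs)).
Proof.
exists psi, phi, cmul.
have phiM X Y : phi (psi (cmul X Y)) = phi (psi X) *m phi (psi Y).
  by rewrite /phi -!/(theta _) thetaM ev_cat.
have phiP t : inP t -> inH' (phi t) /\ phi t *m v101 = tri t.
  move=> /word_ofP[Hw E]; split; last by rewrite ev_v101 E.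
  by apply/inH'_ev; exists (word_of t).
have phi_inj t1 t2 : inP t1 -> inP t2 -> phi t1 = phi t2 -> t1 = t2.
  move=> /phiP[_ E1] /phiP[_ E2] E; apply: tri_inj; by rewrite -E1 E E2.
have phi_surj M : inH' M -> exists t, inP t /\ phi t = M.
  move=> /inH'_ev[w Hw ->]; exists (act w); split; first exact: act_inP.
  by rewrite /phi act_word_of.
split; first exact: psiE.
split; first by split; [exact: psi_inP | split; [exact: psi_inj | exact: psi_surj]].
split.
  split=> // t M Pt /inH'_ev[w Hw ->]; rewrite ev_v101 => /tri_inj <-.
  by rewrite /phi act_word_of.
split=> //.
split; first by move=> X Y; rewrite -phiM (phiP _ (psi_inP _)).2.
split.
  split; [exact: cmul_monoid | | | exact: cmul_not_fg].
    exists (irreducible cmul C11).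
    apply: (stable_submonoid_free cmul_monoid theta_inj theta1 thetaM); exact: theta_stable.
  (* The words [ABCB] and [CBAB] differ. *)
  exists (class_of [:: LA; LB]), (class_of [:: LC; LB]) => /(congr1 theta).
  by rewrite !thetaM !class_ofK.
split.
  split=> //.
  - by rewrite /phi -/(theta _) theta1.
  - by move=> X; case: (phiP _ (psi_inP X)).
  - by move=> X Y /phi_inj E; apply: psi_inj; apply: E; exact: psi_inP.
  - move=> M /phi_surj[t [/psi_surj[X <-] <-]]; by exists X.
by move=> Bs; apply: (free_basis_cayley cmul_monoid); exact: cmul_not_fg.
Qed.
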